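(* Let $n\ge 1$ and $a\in\mathbb{C}$. The boundary of $W(J_n(a))$ contains a line segment if and only if $n\ge 3$ and $|a|=1$.
   Context: For $n\ge 1$ and $a\in\mathbb{C}$, the KMS matrix $J_n(a)$ is the $n\times n$ strictly upper-triangular matrix whose $(i,j)$ entry is $a^{j-i}$ if $i<j$ and $0$ if $i\ge j$. The numerical range of an $n\times n$ complex matrix $A$ is $W(A)=\{\langle Ax,x\rangle: x\in\mathbb{C}^n,\ \|x\|=1\}$. A line segment means a nondegenerate one (with two distinct endpoints). *)

(* Defs.v *)
From HB Require Import structures.
From mathcomp Require Import all_boot all_order all_algebra.
From mathcomp Require Import sesquilinear spectral complex.
From mathcomp Require Import all_classical all_reals all_analysis.

Set Implicit Arguments.
Unset Strict Implicit.
Unset Printing Implicit Defensive.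

Import Order.TTheory GRing.Theory Num.Theory.
Import numFieldNormedType.Exports.

Local Open Scope classical_set_scope.
Local Open Scope complex_scope.
Local Open Scope ring_scope.

Definition KMS (C : numClosedFieldType) (n : nat) (a : C) : 'M[C]_n :=
  \matrix_(i < n, j < n) (if (i < j)%N then a ^+ (j - i) else 0).

(* dotmx is stated for row vectors; it is linear in its first argument and
   conjugate-linear in the second. *)
Definition inner (C : numClosedFieldType) (n : nat) (x y : 'cV[C]_n) : C :=
  dotmx x^T y^T.

Definition enorm (C : numClosedFieldType) (n : nat) (x : 'cV[C]_n) : C :=
  sqrtC (inner x x).

Definition numerical_range (C : numClosedFieldType) (n : nat) (A : 'M[C]_n) :
    set C :=
  [set inner (A *m x) x | x in [set x : 'cV[C]_n | enorm x = 1]].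

Definition boundary (T : topologicalType) (A : set T) : set T :=
  closure A `\` interior A.

Definition segment (R : realType) (p q : R[i]) : set R[i] :=
  [set (1 - t)%:C * p + t%:C * q | t in [set t : R | 0 <= t <= 1]].

Definition contains_line_segment (R : realType) (A : set R[i]) : Prop :=
  exists p q : R[i], p <> q /\ segment p q `<=` A.

Lemma innerE (C : numClosedFieldType) (n : nat) (x y : 'cV[C]_n) :
  inner x y = \sum_(i < n) x i 0 * (y i 0)^*%R.
Proof.
by rewrite /inner dotmxE mxE; apply: eq_bigr => i _; rewrite !mxE.
Qed.

(* Main.v *)
(* Write J for the KMS matrix. W(J) is convex and closed, so a segment in its
   boundary lies on a supporting line: there are w <> 0 and a real k such that
   w z + conj (w z) <= k on W(J), with equality on the segment. Unit vectors x
   realising points of that line satisfy w J x + conj w J^* x = k x. If a <> 0,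
   the recurrences (J x)_i = a (x_{i+1} + (J x)_{i+1}) and
   (J^* x)_{i+1} = conj a (x_i + (J^* x)_i) show that such an x is determined by
   its first coordinate, unless k + w = 0, |a| = 1 and n >= 3; hence the
   supporting line meets W(J) in a single point. Conversely, if |a| = 1 and
   y_j = a^j x_j, then 2 Re <J x, x> = |sum_j y_j|^2 - |x|^2, so Re z >= -1/2 on
   W(J), and for n >= 3 equality is attained at two distinct points. *)
Require Import Defs.
From mathcomp Require Import all_boot all_order all_algebra.
From mathcomp Require Import complex ring lra.
From mathcomp Require Import all_classical all_reals all_analysis.
Import Order.TTheory GRing.Theory Num.Theory.
Import numFieldNormedType.Exports.
Local Open Scope ring_scope.

Set Implicit Arguments.
Unset Strict Implicit.

(** * Hermitian inner product and adjoint *)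

Definition adjmx (C : numClosedFieldType) (m n : nat) (A : 'M[C]_(m, n)) :
  'M[C]_(n, m) := \matrix_(i, j) (A j i)^*.

Lemma inner_conj (C : numClosedFieldType) n (x y : 'cV[C]_n) :
  (inner x y)^* = inner y x.
Proof.
rewrite !innerE rmorph_sum; apply: eq_bigr => i _.
by rewrite rmorphM /= conjCK mulrC.
Qed.

Lemma innerDl (C : numClosedFieldType) n (x y z : 'cV[C]_n) :
  inner (x + y) z = inner x z + inner y z.
Proof.
by rewrite !innerE -big_split; apply: eq_bigr => i _; rewrite !mxE mulrDl.
Qed.

Lemma innerDr (C : numClosedFieldType) n (x y z : 'cV[C]_n) :
  inner z (x + y) = inner z x + inner z y.
Proof. by rewrite -[LHS]inner_conj innerDl rmorphD /= !inner_conj. Qed.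

Lemma innerZl (C : numClosedFieldType) n (c : C) (x y : 'cV[C]_n) :
  inner (c *: x) y = c * inner x y.
Proof.
by rewrite !innerE mulr_sumr; apply: eq_bigr => i _; rewrite !mxE mulrA.
Qed.

Lemma innerZr (C : numClosedFieldType) n (c : C) (x y : 'cV[C]_n) :
  inner x (c *: y) = c^* * inner x y.
Proof. by rewrite -[LHS]inner_conj innerZl rmorphM /= !inner_conj. Qed.

Lemma inner_ge0 (C : numClosedFieldType) n (x : 'cV[C]_n) : 0 <= inner x x.
Proof. by rewrite innerE sumr_ge0// => i _; rewrite mul_conjC_ge0. Qed.

Lemma inner_eq0 (C : numClosedFieldType) n (x : 'cV[C]_n) :
  (inner x x == 0) = (x == 0).
Proof.
apply/eqP/eqP => [|->]; last first.
  by rewrite innerE big1// => i _; rewrite mxE mul0r.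
rewrite innerE => /eqP; rewrite psumr_eq0; last first.
  by move=> i _; rewrite mul_conjC_ge0.
move=> /allP x0; apply/colP => i; rewrite mxE.
by have := x0 i (mem_index_enum i); rewrite mul_conjC_eq0 => /eqP.
Qed.

Lemma enorm_eq1 (C : numClosedFieldType) n (x : 'cV[C]_n) :
  enorm x = 1 <-> inner x x = 1.
Proof.
rewrite /enorm; split=> [x1|->]; last exact: sqrtC1.
by rewrite -[LHS]sqrtCK x1 expr1n.
Qed.

Lemma inner_adj (C : numClosedFieldType) n (A : 'M[C]_n) (x y : 'cV[C]_n) :
  inner (A *m x) y = inner x (adjmx A *m y).
Proof.
rewrite !innerE.
transitivity (\sum_i \sum_j A i j * x j 0 * (y i 0)^*).
  by apply: eq_bigr => i _; rewrite mxE mulr_suml.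
rewrite exchange_big; apply: eq_bigr => j _.
rewrite mxE rmorph_sum mulr_sumr; apply: eq_bigr => i _.
by rewrite mxE rmorphM /= conjCK; ring.
Qed.

(** * Convexity of the numerical range (Toeplitz-Hausdorff) *)

Lemma numerical_rangeP (C : numClosedFieldType) n (A : 'M[C]_n) z :
  numerical_range A z <->
  exists x, inner x x = 1 /\ inner (A *m x) x = z.
Proof.
split=> [[x /enorm_eq1 x1 xz]|[x [/enorm_eq1 x1 xz]]]; first by exists x.
by exists x.
Qed.

Lemma numerical_rangeZ (C : numClosedFieldType) n (A : 'M[C]_n) x z :
  x != 0 -> inner (A *m x) x = z * inner x x -> numerical_range A z.
Proof.
rewrite -inner_eq0 => x0 xz; apply/numerical_rangeP.
have s0 : sqrtC (inner x x) != 0 by rewrite sqrtC_eq0.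
have sr : (sqrtC (inner x x))^* = sqrtC (inner x x).
  by apply: conj_Creal; rewrite ger0_real// sqrtC_ge0 inner_ge0.
exists ((sqrtC (inner x x))^-1 *: x).
rewrite -scalemxAr !innerZl !innerZr fmorphV /= sr xz.
rewrite -[X in _ * (_ * X) = 1 /\ _ * (_ * (_ * X)) = _]sqrtCK.
by split; field.
Qed.

(* A zero of a sesquilinear form taking the values [-t] and [1 - t] is found on
   the real line through [u *: x] and [y]: there the form is a real quadratic
   polynomial once [u] cancels the imaginary part of the cross terms. *)
Lemma numerical_range_convex (C : numClosedFieldType) n (A : 'M[C]_n) p q t :
  numerical_range A p -> numerical_range A q -> 0 <= t <= 1 ->
  numerical_range A ((1 - t) * p + t * q).
Proof.
move=> Wp Wq /andP[t0 t1].
have [->|tn0] := eqVneq t 0; first by rewrite subr0 mul1r mul0r addr0.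
have [->|pq] := eqVneq q p; first by rewrite -mulrDl subrK mul1r.
have d0 : q - p != 0 by rewrite subr_eq0.
move/numerical_rangeP: Wp => [x [x1 xp]].
move/numerical_rangeP: Wq => [y [y1 yq]].
set m := (1 - t) * p + t * q.
pose F (v w : 'cV[C]_n) := (inner (A *m v) w - m * inner v w) / (q - p).
have [u [uu kr]] : exists u : C, u * u^* = 1 /\
    u * F x y + u^* * F y x \is Num.real.
  pose g := F x y - (F y x)^*.
  have [g0|g0] := eqVneq g 0.
    exists 1; rewrite conjC1 !mul1r; split=> //.
    have -> : F x y = (F y x)^* by apply/eqP; rewrite -subr_eq0; apply/eqP.
    by rewrite CrealE rmorphD /= conjCK addrC.
  have ng0 : `|g| != 0 by rewrite normr_eq0.
  have cg : `|g|^* = `|g| by exact: conj_Creal.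
  (* The cross terms have the imaginary part of [u * g], and this [u] makes [u * g] equal to the
     real number [|g|]. *)
  exists (g^* / `|g|); rewrite rmorphM fmorphV /= cg conjCK; split.
    have -> : g^* / `|g| * (g / `|g|) = g * g^* / `|g| ^+ 2 by field.
    by rewrite normCK divff// mul_conjC_eq0.
  have -> : g^* / `|g| * F x y + g / `|g| * F y x =
      (`|g| ^+ 2 + (g^* * (F y x)^* + g * F y x)) / `|g|.
    rewrite normCK [X in X * g^*](erefl : g = F x y - (F y x)^*).
    by field.
  rewrite rpredM ?rpredV// ?normr_real// rpredD ?rpredX ?normr_real//.
  by rewrite CrealE rmorphD !rmorphM /= !conjCK addrC.
set k := _ + _ in kr.
have Fxx : F x x = - t by rewrite /F xp x1 /m; field.
have Fyy : F y y = 1 - t by rewrite /F yq y1 /m; field.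
(* [D] is the discriminant of [- t * X ^+ 2 + k * X + (1 - t)], nonnegative because [0 < t <= 1];
   [al] is a real root. *)
pose D := k ^+ 2 + 4 * t * (1 - t).
have D0 : 0 <= D.
  apply: addr_ge0; first by rewrite real_exprn_even_ge0.
  by rewrite !mulr_ge0 ?subr_ge0 ?ler0n.
pose al := (k + sqrtC D) / (2 * t).
have alr : al^* = al.
  have sr : sqrtC D \is Num.real by rewrite ger0_real// sqrtC_ge0.
  apply: conj_Creal; apply: realM; first exact: realD.
  by rewrite realV ger0_real// mulr_ge0// ler0n.
have alE : - t * al ^+ 2 + k * al + (1 - t) = 0.
  have /(congr1 (fun z => z - D)) := sqrtCK D; rewrite subrr => sD.
  have -> : - t * al ^+ 2 + k * al + (1 - t) = - (sqrtC D ^+ 2 - D) / (4 * t).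
    by rewrite /al /D; field.
  by rewrite sD oppr0 mul0r.
have Fz : F (al *: (u *: x) + y) (al *: (u *: x) + y) = 0.
  rewrite -[RHS]alE -Fyy -[t]opprK -Fxx.
  transitivity (- - F x x * al ^+ 2 * (u * u^*) + k * al + F y y); last first.
    by rewrite uu mulr1.
  rewrite /k /F !mulmxDr -!scalemxAr !(innerDl, innerDr, innerZl, innerZr) alr.
  by field.
apply: (@numerical_rangeZ _ _ _ (al *: (u *: x) + y)).
  (* If the vector vanished, [y] would be a multiple of [x] by a scalar of modulus 1, forcing
     [F y y = F x x], that is [1 - t = - t]. *)
  apply/negP => /eqP z0.
  have yE : y = - (al * u) *: x.
    by apply/eqP; rewrite scaleNr -scalerA -subr_eq0 opprK addrC z0.
  have : F y y = (al * u) * (al * u)^* * F x x.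
    by rewrite /F yE -scalemxAr !innerZl !innerZr rmorphN; field.
  have : inner y y = (al * u) * (al * u)^* * inner x x.
    by rewrite yE !innerZl !innerZr rmorphN; ring.
  rewrite x1 y1 mulr1 => <-; rewrite Fxx Fyy mul1r => /eqP.
  by rewrite -subr_eq0 opprK subrK oner_eq0.
move/eqP: Fz; rewrite mulf_eq0 invr_eq0 (negPf d0) orbF subr_eq0.
by move/eqP.
Qed.

(** * Supporting lines and eigenvectors *)

Lemma psd_kernel (C : numClosedFieldType) n (B : 'M[C]_n) (x : 'cV[C]_n) :
  adjmx B = B -> (forall y, 0 <= inner (B *m y) y) ->
  inner (B *m x) x = 0 -> B *m x = 0.
Proof.
move=> Bh Bp Bx; pose v := B *m x; apply/eqP; rewrite -inner_eq0 -/v.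
have := Bp v; have := inner_ge0 v; set N := inner v v.
set b := inner (B *m v) v.
move=> N0 b0; have b1 : 0 < b + 1 by rewrite ltr_wpDl.
(* The quadratic polynomial [<B (x - s v), x - s v>] is negative at this [s]
   unless [v = 0]. *)
pose s := N / (b + 1).
have sr : s^* = s by apply: conj_Creal; rewrite ger0_real// divr_ge0// ltW.
have := Bp (x - s *: v).
rewrite mulmxBr -scalemxAr -[- (s *: v)]scaleNr -scaleNr.
rewrite !(innerDl, innerDr, innerZl, innerZr) rmorphN /= sr Bx -/v -/N -/b.
have -> : inner (B *m v) x = N by rewrite inner_adj Bh.
have -> : 0 + - s * N + (- s * N + - s * (- s * b)) =
    - (N ^+ 2 * ((b + 2) / (b + 1) ^+ 2)).
  by rewrite /s; field; rewrite lt0r_neq0.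
rewrite oppr_ge0 pmulr_lle0; last first.
  by rewrite divr_gt0 ?exprn_gt0// ltr_wpDl// ltr0n.
by rewrite real_exprn_even_le0 ?ger0_real.
Qed.

Lemma support_eigen (C : numClosedFieldType) n (A : 'M[C]_n) (w k : C)
    (x : 'cV[C]_n) :
  (forall z, numerical_range A z -> w * z + (w * z)^* <= k) ->
  inner x x = 1 ->
  w * inner (A *m x) x + (w * inner (A *m x) x)^* = k ->
  w *: (A *m x) + w^* *: (adjmx A *m x) = k *: x.
Proof.
move=> Wk x1 xk.
have kr : k^* = k by rewrite -xk rmorphD /= conjCK addrC.
pose B := k%:M - (w *: A + w^* *: adjmx A).
have BE y : inner (B *m y) y =
    k * inner y y - (w * inner (A *m y) y + (w * inner (A *m y) y)^*).
  rewrite mulmxBl mul_scalar_mx mulmxDl -!scalemxAl -scaleN1r.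
  rewrite !innerDl !innerZl innerDl !innerZl rmorphM /= inner_conj.
  by rewrite -[inner y (A *m y)]inner_conj inner_adj inner_conj; ring.
suff : B *m x = 0.
  rewrite mulmxBl mul_scalar_mx mulmxDl -!scalemxAl => /eqP.
  by rewrite subr_eq0 => /eqP ->.
apply: psd_kernel.
- apply/matrixP => i j; rewrite !mxE !(rmorphB, rmorphD, rmorphM, rmorphMn) /=.
  by rewrite !conjCK kr eq_sym; ring.
- move=> y; rewrite BE.
  have [->|y0] := eqVneq y 0.
    rewrite mulmx0.
    have /eqP -> : inner (0 : 'cV[C]_n) 0 == 0 by rewrite inner_eq0.
    by rewrite !mulr0 conjC0 addr0 subr0.
  have N0 : 0 < inner y y by rewrite lt0r inner_eq0 y0 inner_ge0.
  have Nr : (inner y y)^* = inner y y by rewrite inner_conj.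
  have /Wk : numerical_range A (inner (A *m y) y / inner y y).
    by apply: (numerical_rangeZ y0); rewrite divfK ?gt_eqF.
  rewrite !rmorphM /= fmorphV /= Nr !mulrA -mulrDl ler_pdivrMr// => h.
  by rewrite subr_ge0.
- by rewrite BE x1 xk mulr1 subrr.
Qed.

(** * Recurrences for the KMS matrix and rigidity of eigenvectors *)

Lemma KMS_mul_step (C : numClosedFieldType) n (a : C)
    (x : 'cV[C]_n) (i j : 'I_n) :
  (j = i.+1 :> nat)%N ->
  (KMS n a *m x) i 0 = a * (x j 0 + (KMS n a *m x) j 0).
Proof.
move=> ji; rewrite !mxE (bigD1 j)//= mxE ji ltnSn subSnn expr1 mulrDr.
congr (_ + _); rewrite [in RHS](bigD1 j)//= mxE ltnn mul0r add0r mulr_sumr.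
apply: eq_bigr => k kj; rewrite !mxE mulrA.
case: ltngtP kj => [ik||ik].
- move=> kj; rewrite -ji in ik; rewrite leq_eqVlt eq_sym in ik.
  case/orP: ik => [/eqP/val_inj kjE|ik]; first by rewrite kjE eqxx in kj.
  by rewrite ik -exprS; congr (a ^+ _ * _); rewrite ji subnSK// -ji ltnW.
- by move=> ik kj; rewrite ltnNge (leq_trans (ltnW ik)) ?ji// mulr0 !mul0r.
- by move=> kj; rewrite ltnNge -ik ji leqnSn mulr0 !mul0r.
Qed.

Lemma KMS_mul_last (C : numClosedFieldType) n (a : C)
    (x : 'cV[C]_n) (i : 'I_n) :
  (i.+1 = n)%N -> (KMS n a *m x) i 0 = 0.
Proof.
move=> iE; rewrite mxE big1// => k _.
by rewrite mxE ltnNge -ltnS iE ltn_ord mul0r.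
Qed.

Lemma KMS_adj_step (C : numClosedFieldType) n (a : C)
    (x : 'cV[C]_n) (i j : 'I_n) :
  (j = i.+1 :> nat)%N ->
  (adjmx (KMS n a) *m x) j 0 = a^* * (x i 0 + (adjmx (KMS n a) *m x) i 0).
Proof.
move=> ji; rewrite !mxE (bigD1 i)//= !mxE ji ltnSn subSnn expr1 mulrDr.
congr (_ + _).
rewrite [in RHS](bigD1 i)//= !mxE ltnn conjC0 mul0r add0r mulr_sumr.
apply: eq_bigr => k ki; rewrite !mxE mulrA ji ltnS.
case: ltngtP ki => [ik|ik|/val_inj ->].
- by rewrite subSn 1?ltnW// exprS rmorphM.
- by rewrite conjC0 mulr0 !mul0r.
- by rewrite eqxx.
Qed.

Lemma KMS_adj_first (C : numClosedFieldType) n (a : C)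
    (x : 'cV[C]_n) (i : 'I_n) :
  (i = 0 :> nat)%N -> (adjmx (KMS n a) *m x) i 0 = 0.
Proof.
by move=> iE; rewrite mxE big1// => k _; rewrite !mxE iE ltn0 conjC0 mul0r.
Qed.

(** This is the injectivity of the map sending an eigenvector to its first coordinate. The
    coordinates of [x], [s = J x] and [t = J^* x] are propagated together by the two recurrences and
    the eigenvalue equation. *)
Lemma KMS_eigen_first0 (C : numClosedFieldType) n (a w k : C)
    (x : 'cV[C]_n.+1) :
  a != 0 -> w != 0 -> k \is Num.real -> (n.+1 < 3)%N || (`|a| != 1) ->
  w *: (KMS n.+1 a *m x) + w^* *: (adjmx (KMS n.+1 a) *m x) = k *: x ->
  x 0 0 = 0 -> x = 0.
Proof.
move=> a0 w0 kr na ev x0.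
set s := KMS n.+1 a *m x in ev; set t := adjmx (KMS n.+1 a) *m x in ev.
have evi i : w * s i 0 + w^* * t i 0 = k * x i 0.
  by have := congr1 (fun z : 'cV_ _ => z i 0) ev; rewrite !mxE.
have t0 : t 0 0 = 0 by exact: KMS_adj_first.
have s0 : s 0 0 = 0.
  by have /eqP := evi 0; rewrite x0 t0 !mulr0 addr0 mulf_eq0 (negPf w0) => /eqP.
(* If row [i] is zero in [x], [s] and [t], the recurrences give [t = 0] and [x = - s] in row
   [i + 1]; the eigenvalue equation there becomes [(k + w) * s = 0]. *)
have [kw|kw] := eqVneq (k + w) 0; last first.
  suff H i (im : (i < n.+1)%N) : [/\ x (Ordinal im) 0 = 0, s (Ordinal im) 0 = 0
      & t (Ordinal im) 0 = 0].
    by apply/colP => -[i im]; have [-> _ _] := H i im; rewrite mxE.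
  elim: i im => [|i IH] im.
    by rewrite (_ : Ordinal im = 0)//; apply: val_inj.
  have [xi si ti] := IH (ltnW im).
  have tS : t (Ordinal im) 0 = 0.
    by rewrite (@KMS_adj_step _ _ _ _ (Ordinal (ltnW im)))// xi ti addr0 mulr0.
  have /eqP : s (Ordinal (ltnW im)) 0 = 0 by [].
  rewrite /s (@KMS_mul_step _ _ _ _ _ (Ordinal im))// -/s mulf_eq0 (negPf a0)/=.
  rewrite addr_eq0 => /eqP xS.
  have /eqP : (k + w) * s (Ordinal im) 0 = 0.
    have /eqP := evi (Ordinal im); rewrite tS xS -subr_eq0 => /eqP <-; ring.
  by rewrite mulf_eq0 (negPf kw) => /eqP sS; rewrite xS sS oppr0.
have wE : w = - k by apply/eqP; rewrite -addr_eq0 addrC kw.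
have k0 : k != 0 by rewrite wE oppr_eq0 in w0.
have sti i : x i 0 = - (s i 0 + t i 0).
  by apply: (mulfI k0); rewrite -evi wE rmorphN /= conj_Creal//
     !mulNr -opprD -mulrDr mulrN.
(* Here [w = - k] is real and [x = - (s + t)], so the recurrences collapse to [t_(i+1) = - a^* s_i]
   and [s_i = - a t_(i+1)]. *)
have st i (im : (i.+1 < n.+1)%N) :
    s (Ordinal (ltnW im)) 0 = `|a| ^+ 2 * s (Ordinal (ltnW im)) 0.
  have tS : t (Ordinal im) 0 = - (a^* * s (Ordinal (ltnW im)) 0).
    rewrite /t (@KMS_adj_step _ _ _ _ (Ordinal (ltnW im)))// -/t sti.
    by rewrite opprD subrK mulrN.
  have sS : s (Ordinal (ltnW im)) 0 = - (a * t (Ordinal im) 0).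
    rewrite [LHS](@KMS_mul_step _ _ _ _ _ (Ordinal im))// -/s sti.
    by rewrite opprD addrAC addNr add0r mulrN.
  by rewrite {1}sS tS mulrN opprK normCK mulrA.
(* In size at most 2, a coordinate other than the first is the last, and [0 = s_0 = a x_1]. If [|a|]
   is not 1, [st] kills every [s_i] but the last, which is always 0; then all [t_i] vanish as
   well. *)
case/orP: na => [n3|na1].
  apply/colP => i; rewrite mxE; have [->//|i0] := eqVneq i 0.
  have i1 : i = 1%N :> nat.
    apply/eqP; rewrite eqn_leq lt0n i0 andbT -ltnS.
    exact: leq_trans (ltn_ord i) (n3 : (n.+1 <= 2)%N).
  have iN : (i.+1 = n.+1)%N by apply/eqP; rewrite eqn_leq ltn_ord i1.
  have /eqP := s0.
  rewrite /s (@KMS_mul_step _ _ _ _ _ i)// KMS_mul_last// addr0.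
  by rewrite mulf_eq0 (negPf a0) => /eqP.
have sz i : s i 0 = 0.
  have [im|im] := ltnP i n; last first.
    by apply: KMS_mul_last; apply/eqP; rewrite eqn_leq ltn_ord.
  have := st i im; rewrite (_ : Ordinal _ = i); last exact: val_inj.
  move=> /eqP; rewrite -subr_eq0 -{1}[s i 0]mul1r -mulrBl mulf_eq0 subr_eq0.
  by rewrite [1 == _]eq_sym sqrp_eq1// (negPf na1) => /eqP.
have tz i (im : (i < n.+1)%N) : t (Ordinal im) 0 = 0.
  elim: i im => [|i IH] im.
    by rewrite (_ : Ordinal im = 0)//; apply: val_inj.
  rewrite /t (@KMS_adj_step _ _ _ _ (Ordinal (ltnW im)))// -/t sti sz add0r.
  by rewrite addNr mulr0.
by apply/colP => -[i im]; rewrite sti sz tz addr0 oppr0 mxE.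
Qed.

(** Unit vectors realising [p] and [q] are eigenvectors for the same eigenvalue. The combination of
    them that cancels the first coordinate is zero, so they differ by a scalar of modulus 1, which
    leaves the form unchanged. *)
Lemma KMS_face_unique (C : numClosedFieldType) n (a w k p q : C) :
  a != 0 -> w != 0 -> (n.+1 < 3)%N || (`|a| != 1) ->
  (forall z, numerical_range (KMS n.+1 a) z -> w * z + (w * z)^* <= k) ->
  numerical_range (KMS n.+1 a) p -> numerical_range (KMS n.+1 a) q ->
  w * p + (w * p)^* = k -> w * q + (w * q)^* = k -> p = q.
Proof.
move=> a0 w0 na Wk /numerical_rangeP[x [x1 <-]].
move=> /numerical_rangeP[y [y1 <-]] pk qk.
have kr : k \is Num.real by rewrite CrealE -pk rmorphD /= conjCK addrC.
have ex := support_eigen Wk x1 pk; have ey := support_eigen Wk y1 qk.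
have x0 : x 0 0 != 0.
  apply/eqP => /(KMS_eigen_first0 a0 w0 kr na ex) xz.
  by have /eqP := x1; rewrite xz (_ : inner 0 0 = 0) 1?eq_sym ?oner_eq0//;
    apply/eqP; rewrite inner_eq0.
have yE : y = (y 0 0 / x 0 0) *: x.
  have z0 : y - (y 0 0 / x 0 0) *: x = 0.
    apply: (KMS_eigen_first0 a0 w0 kr na); last by rewrite !mxE divfK// subrr.
    have scalerC (b c : C) (v : 'cV[C]_n.+1) : b *: (c *: v) = c *: (b *: v).
      by rewrite !scalerA mulrC.
    rewrite !mulmxBr -!scalemxAr !scalerBr -ey [k *: (_ *: x)]scalerC -ex.
    by rewrite scalerDr ![_ *: (_ / _ *: _)]scalerC opprD addrACA.
  by apply/eqP; rewrite -subr_eq0 z0.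
set c := y 0 0 / x 0 0 in yE.
have cc : c * c^* = 1.
  by move: y1; rewrite yE innerZl innerZr x1 mulr1.
by rewrite yE -scalemxAr innerZl innerZr mulrA cc mul1r.
Qed.

(** * Supporting line through a segment in the boundary of a convex set *)

Local Open Scope classical_set_scope.
Local Open Scope complex_scope.

(* [u] and the segment [p, q] span a triangle; it contains a half-neighbourhood
   of the midpoint of [p, q], on the side of [u]. *)
Lemma triangle_half_nbhs (R : realType) (W : set R[i]) (p q u : R[i]) :
  (forall x y t, W x -> W y -> 0 <= t <= 1 -> W ((1 - t) * x + t * y)) ->
  W p -> W q -> W u -> q != p -> complex.Im ((u - p) / (q - p)) != 0 ->
  exists2 e : R, 0 < e & forall xi eta : R, `|xi| <= e -> `|eta| <= e ->
    0 <= eta * complex.Im ((u - p) / (q - p)) ->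
    W ((p + q) / 2 + (q - p) * (xi +i* eta)).
Proof.
move=> cW Wp Wq Wu qp.
have d0 : q - p != 0 by rewrite subr_eq0.
case zE : ((u - p) / (q - p)) => [v1 v2] /= v20.
have uE : u = p + (q - p) * (v1 +i* v2) by rewrite -zE; field.
(* The second bound gives [s * (|v1| + 2) <= 1/8] for the weight [s] of [u] below. Then [s <= 1/16],
   and [xi] and [s * (v1 - 1/2)] are both at most 1/8 in modulus, which keeps [t] in [0, 1]. *)
exists (Num.min 8^-1 (`|v2| / (8 * (`|v1| + 2)))).
  by rewrite lt_min divr_gt0 ?normr_gt0// ?invr_gt0 ?ltr0n// mulr_gt0 ?ltr0n// ltr_wpDl.
move=> xi eta; rewrite !le_min => /andP[xi8 _] /andP[_ eta8] ev0.
pose s := eta / v2.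
have s0 : 0 <= s.
  have -> : s = eta * v2 / v2 ^+ 2 by rewrite /s; field.
  by rewrite divr_ge0// sqr_ge0.
have v1p : 0 < `|v1| + 2 by rewrite ltr_wpDl.
have sle : s * (`|v1| + 2) <= 8^-1.
  rewrite -[s]ger0_norm// normrM normfV.
  rewrite -ler_pdivlMr// ler_pdivrMr ?normr_gt0//.
  apply: (le_trans eta8); rewrite le_eqVlt; apply/orP; left; apply/eqP.
  by field; rewrite gt_eqF.
have nv1 := normr_ge0 v1.
have s8 : s <= 16^-1 by nra.
have sv : `|s * v1| <= 8^-1 by rewrite normrM (ger0_norm s0); nra.
have svh : `|s * (v1 - 2^-1)| <= 8^-1.
  rewrite normrM (ger0_norm s0); have := ler_normB v1 2^-1.
  by rewrite [`|2^-1|]ger0_norm ?invr_ge0// => h; nra.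
have s1 : 1 - s != 0 by rewrite gt_eqF//; lra.
(* In the coordinate where [p = 0] and [q = 1], [s] and [t] solve [(1 - s) * t + s * (v1 + i v2) =
   1/2 + xi + i eta]. *)
pose t := ((xi - s * (v1 - 2^-1)) / (1 - s) + 2^-1).
have t01 : 0 <= t <= 1.
  have := xi8; have := svh; rewrite !ler_norml => /andP[h1 h2] /andP[h3 h4].
  have s1p : 0 < 1 - s by lra.
  have h : - 2^-1 <= (xi - s * (v1 - 2^-1)) / (1 - s) <= 2^-1.
    by rewrite ler_pdivlMr// ler_pdivrMr//; apply/andP; split; lra.
  by rewrite /t; move/andP: h => [h5 h6]; apply/andP; split; lra.
have tC : (0 : R[i]) <= t%:C <= 1 by rewrite !lecR.
have sC : (0 : R[i]) <= s%:C <= 1 by rewrite !lecR s0; lra.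
have := cW _ _ _ (cW _ _ _ Wp Wq tC) Wu sC.
congr W; rewrite uE.
have -> : v1 +i* v2 = v1%:C + 'i * v2%:C by simpc.
have -> : xi +i* eta = xi%:C + 'i * eta%:C by simpc.
have -> : eta = s * v2 by rewrite /s divfK.
have -> : xi = (t - 2^-1) * (1 - s) + s * (v1 - 2^-1) by rewrite /t; field.
clearbody s t; clear -s t.
rewrite !(rmorphM, rmorphD, rmorphN, rmorph1, fmorphV) /=.
by field.
Qed.

(** Radii of balls in [R[i]] are themselves elements of [R[i]]; this form makes them real. *)
Lemma interior_ball (R : realType) (W : set (R[i] : numClosedFieldType))
    (z : R[i]) :
  interior W z <-> exists2 e : R, 0 < e & forall y, `|z - y| < e%:C -> W y.
Proof.
split=> [/nbhs_ballP[e /= e0 zW]|[e e0 zW]].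
  have [r rE] := complex_realP _ (gtr0_real e0).
  by exists r => [|y zy]; [rewrite -ltcR -rE|apply: zW; rewrite /ball/= rE].
by apply/nbhs_ballP; exists e%:C => /=; [rewrite ltcR|move=> y; exact: zW].
Qed.

(** The supporting line is the line through [p] and [q], and [h z] measures the signed offset of [z]
    from it. Points of [W] strictly on both sides would give two half-neighbourhoods of the
    midpoint, making it interior. *)
Lemma segment_support (R : realType) (W : set (R[i] : numClosedFieldType))
    (p q : R[i]) :
  (forall x y t, W x -> W y -> 0 <= t <= 1 -> W ((1 - t) * x + t * y)) ->
  W p -> W q -> q != p -> ~ interior W ((p + q) / 2) ->
  exists w k : R[i], [/\ w != 0, forall z, W z -> w * z + (w * z)^*%R <= k,
    w * p + (w * p)^*%R = k & w * q + (w * q)^*%R = k].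
Proof.
move=> cW Wp Wq qp nint; have d0 : q - p != 0 by rewrite subr_eq0.
pose h z := complex.Im ((z - p) / (q - p)).
have side : (forall z, W z -> h z <= 0) \/ (forall z, W z -> 0 <= h z).
  apply: contrapT => /not_orP[] /existsNP[u /not_implyP[Wu /negP]].
  rewrite -ltNge => hu /existsNP[v /not_implyP[Wv /negP]]; rewrite -ltNge => hv.
  apply: nint; apply/interior_ball.
  have [e1 e10 H1] := triangle_half_nbhs cW Wp Wq Wu qp (lt0r_neq0 hu).
  have [e2 e20 H2] := triangle_half_nbhs cW Wp Wq Wv qp (ltr0_neq0 hv).
  have [r rE] := complex_realP _ (normr_real (q - p)).
  have r0 : 0 < r by rewrite -ltcR -rE normr_gt0.
  exists (Num.min e1 e2 * r) => [|y]; first by rewrite mulr_gt0// lt_min e10.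
  rewrite rmorphM /= -rE -ltr_pdivrMr ?normr_gt0// distrC -normf_div.
  case zE : ((y - (p + q) / 2) / (q - p)) => [xi eta] ye.
  have -> : y = (p + q) / 2 + (q - p) * (xi +i* eta) by rewrite -zE; field.
  have [xe ee] : `|xi| <= Num.min e1 e2 /\ `|eta| <= Num.min e1 e2.
    split; rewrite -lecR; apply: le_trans (ltW ye).
      exact: (normc_ge_Re (xi +i* eta)).
    (* Multiplication by [i] moves [eta] into the real part, up to sign. *)
    have := normc_ge_Re ((xi +i* eta) * 'i%C).
    by rewrite ReiNIm normrN [leRHS]normrM complexiE normCi mulr1.
  move: xe ee; rewrite !le_min => /andP[x1 x2] /andP[y1 y2].
  have [eta0|eta0] := leP 0 eta.
    by apply: H1 => //; rewrite mulr_ge0// ltW.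
  by apply: H2 => //; rewrite mulr_le0// ltW.
have aux (w : R[i]) z : w * z + (w * z)^*%R - (w * p + (w * p)^*%R) =
    w * (z - p) + (w * (z - p))^*%R.
  by rewrite mulrBr rmorphB /=; ring.
have hE z (c : R[i]) : c^*%R = - c ->
    c / (q - p) * (z - p) + (c / (q - p) * (z - p))^*%R =
    c * 'i%C * (h z *+ 2)%:C.
  move=> cN; rewrite -mulrA [_^-1 * _]mulrC rmorphM /= cN /h.
  case: ((z - p) / (q - p)) => u v /=.
  have -> : (u +i* v)^*%R = u -i* v :> R[i] by [].
  rewrite mulNr -mulrBr -mulrA; congr (c * _).
  by apply/eqP; rewrite eq_complex; simpc.
have iN : ('i%C : R[i])^*%R = - 'i%C.
  by apply/eqP; rewrite eq_complex; simpc.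
have ii : 'i%C * 'i%C = -1 :> R[i] by rewrite -expr2 sqr_i.
have hp : h p = 0 by rewrite /h subrr mul0r.
have hq : h q = 0 by rewrite /h divff.
have i0 : 'i%C != 0 :> R[i] by rewrite eq_complex /= oner_eq0 andbF.
(* With [w = c / (q - p)] and [c] equal to [i] or [- i], the functional relative to [p] is [- 2 h]
   or [2 h]; the sign is chosen according to the side containing [W]. *)
have [c [c0 cN cs]] : exists c : R[i], [/\ c != 0, c^*%R = - c &
    forall z, W z -> c * 'i%C * (h z *+ 2)%:C <= 0].
  case: side => side.
    exists (- 'i%C); split; rewrite ?oppr_eq0// ?rmorphN /= ?iN// => z /side hz.
    by rewrite mulNr ii opprK mul1r lecR mulrn_wle0.
  exists 'i%C; split=> // z /side hz.
  by rewrite ii mulN1r oppr_le0 ler0c mulrn_wge0.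
exists (c / (q - p)), (c / (q - p) * p + (c / (q - p) * p)^*%R); split=> //.
- by rewrite mulf_neq0// invr_eq0.
- by move=> z Wz; rewrite -subr_le0 aux// hE// cs.
- apply/eqP; rewrite -subr_eq0 aux// hE// hq mul0rn.
  by rewrite mulr0.
Qed.

(** * Closedness of the numerical range *)

Definition complex_col (R : realType) n (v : 'rV[R]_(n + n)) : 'cV[R[i]]_n :=
  \col_j (v 0 (lshift n j) +i* v 0 (rshift n j)).

Lemma complex_col_onto (R : realType) n (x : 'cV[R[i]]_n) :
  exists v, complex_col v = x.
Proof.
exists (row_mx (map_mx (@complex.Re R) x^T) (map_mx (@complex.Im R) x^T)).
apply/colP => j; rewrite mxE row_mxEl row_mxEr !mxE.
by case: (x j 0).
Qed.

Lemma real_complex_continuous (R : realType) :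
  continuous (fun r : R => r%:C : (R[i] : numClosedFieldType)).
Proof.
move=> r; apply/cvgrPdist_lt => e e0.
have [s sE] := complex_realP _ (gtr0_real e0).
have s0 : 0 < s by rewrite -ltcR -sE.
near=> t; rewrite sE -rmorphB /= normc_def /= expr0n addr0 sqrtr_sqr ltcR.
near: t; exact: cvgr_dist_lt.
Unshelve. all: by end_near. Qed.

Lemma continuous_add (K : numFieldType) (T : topologicalType) (f g : T -> K) :
  continuous f -> continuous g -> continuous (fun x => f x + g x).
Proof. by move=> cf cg x; apply: cvgD; [exact: cf|exact: cg]. Qed.

Lemma continuous_mul (K : numFieldType) (T : topologicalType) (f g : T -> K) :
  continuous f -> continuous g -> continuous (fun x => f x * g x).
Proof. by move=> cf cg x; apply: cvgM; [exact: cf|exact: cg]. Qed.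

Lemma inner_complex_col_continuous (R : realType) n (A : 'M[R[i]]_n) :
  continuous (fun v : 'rV[R]_(n + n) =>
    inner (A *m complex_col v) (complex_col v) : (R[i] : numClosedFieldType)).
Proof.
have rc (j : 'I_(n + n)) : continuous (fun v : 'rV[R]_(n + n) =>
    (v 0 j)%:C : (R[i] : numClosedFieldType)).
  by move=> v; exact: (continuous_comp (@coord_continuous _ _ _ _ _ v)
    (@real_complex_continuous _ _)).
(* Written in real and imaginary parts, the form is a polynomial in real coordinates, with no
   conjugation left. *)
rewrite (_ : (fun v => _) = fun v : 'rV[R]_(n + n) =>
  \sum_i 
    (\sum_j A i j * ((v 0 (lshift n j))%:C + 'i * (v 0 (rshift n j))%:C)) *
    ((v 0 (lshift n i))%:C + (- 'i) * (v 0 (rshift n i))%:C)).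
  have xc j : continuous (fun v : 'rV[R]_(n + n) =>
      (v 0 (lshift n j))%:C + 'i * (v 0 (rshift n j))%:C
      : (R[i] : numClosedFieldType)).
    apply: continuous_add; first exact: rc.
    by apply: continuous_mul; [exact: cst_continuous|exact: rc].
  have yc j : continuous (fun v : 'rV[R]_(n + n) =>
      (v 0 (lshift n j))%:C + (- 'i) * (v 0 (rshift n j))%:C
      : (R[i] : numClosedFieldType)).
    apply: continuous_add; first exact: rc.
    by apply: continuous_mul; [exact: cst_continuous|exact: rc].
  have sc i : continuous (fun v : 'rV[R]_(n + n) =>
      \sum_j A i j * ((v 0 (lshift n j))%:C + 'i * (v 0 (rshift n j))%:C)
      : (R[i] : numClosedFieldType)).
    apply: continuous_big => [|j _]; first exact: add_continuous.
    by apply: continuous_mul; [exact: cst_continuous|exact: xc].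
  apply: continuous_big => [|i _]; first exact: add_continuous.
  by apply: continuous_mul; [exact: sc|exact: yc].
apply/funext => v; rewrite innerE; apply: eq_bigr => i _.
rewrite !mxE; congr (_ * _); last by apply/eqP; rewrite eq_complex; simpc.
by apply: eq_bigr => j _; rewrite mxE; congr (_ * _); simpc.
Qed.

Lemma inner_coord_le1 (C : numClosedFieldType) n (x : 'cV[C]_n) j :
  inner x x = 1 -> `|x j 0| <= 1.
Proof.
rewrite innerE (bigD1 j)//= -normCK => x1.
rewrite -(@expr_le1 _ 2)// -x1 lerDl sumr_ge0// => i _.
exact: mul_conjC_ge0.
Qed.

(** The unit sphere, read in real coordinates through [complex_col], is closed and bounded, hence
    compact; its continuous image is compact, hence closed. *)
Lemma numerical_range_closed (R : realType) n (A : 'M[R[i]]_n) :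
  closed (numerical_range A).
Proof.
pose S := [set v : 'rV[R]_(n + n) | inner (complex_col v) (complex_col v) = 1].
have -> : numerical_range A =
    [set inner (A *m complex_col v) (complex_col v) | v in S].
  apply/seteqP; split=> z.
    move=> /numerical_rangeP[x [x1 <-]]; have [v vx] := complex_col_onto x.
    by exists v; rewrite /S/= vx.
  by move=> [v v1 <-]; apply/numerical_rangeP; exists (complex_col v).
apply: compact_closed; first exact: norm_hausdorff.
apply: continuous_compact.
  apply: continuous_subspaceT; exact: inner_complex_col_continuous.
apply: bounded_closed_compact.
  exists 1; split=> // M M1 v /= v1; apply: le_trans (ltW M1).
  rewrite /Num.norm /= mx_normrE; apply/bigmax_leP; split=> //=.
  move=> -[i j] _ /=; rewrite ord1.
  have cj k : `|complex_col v k 0| <= 1 by exact: inner_coord_le1.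
  rewrite -(splitK j) -lecR; case: (fintype.split j) => k /=.
    have := cj k; rewrite mxE; apply: le_trans.
    exact: (normc_ge_Re (v 0 (lshift n k) +i* v 0 (rshift n k))).
  have := cj k; rewrite mxE; apply: le_trans.
  have := normc_ge_Re ((v 0 (lshift n k) +i* v 0 (rshift n k)) * 'i%C).
  by rewrite ReiNIm normrN [leRHS]normrM complexiE normCi mulr1.
have -> : S = (fun v : 'rV[R]_(n + n) =>
    inner (1%:M *m complex_col v) (complex_col v) : (R[i] : numClosedFieldType))
    @^-1` [set 1].
  by apply/funext => v; rewrite /S/= mul1mx.
apply: closed_comp; first by move=> v _; exact: inner_complex_col_continuous.
apply: accessible_closed_set1; apply: hausdorff_accessible.
exact: norm_hausdorff.
Qed.

(** * A boundary segment when [|a| = 1] *)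

Lemma KMS_form_unimodular (C : numClosedFieldType) n (a : C) (x : 'cV[C]_n) :
  `|a| = 1 ->
  inner (KMS n a *m x) x =
  \sum_(i < n) \sum_(j < n | (i < j)%N) (a ^+ j * x j 0) * (a ^+ i * x i 0)^*%R.
Proof.
move=> a1; have aa : a * a^*%R = 1 by rewrite -normCK a1 expr1n.
rewrite innerE; apply: eq_bigr => i _; rewrite mxE mulr_suml [RHS]big_mkcond.
apply: eq_bigr => j _; rewrite mxE; case: ifP => [ij|_]; last by rewrite !mul0r.
(* Since [a * a^* = 1], the entry [a^(j-i)] equals [a^j * (a^i)^*]. *)
rewrite -{2}(subnK (ltnW ij)) exprD rmorphM rmorphXn /=.
transitivity (a ^+ (j - i) * x j 0 * (x i 0)^*%R * (a * a^*%R) ^+ i).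
  by rewrite aa expr1n mulr1.
by rewrite exprMn; ring.
Qed.

(** Expanding the square gives the pairs [i < j] (the form), the pairs [j < i] (its conjugate) and
    the diagonal (the squared norm). *)
Lemma KMS_form_re (C : numClosedFieldType) n (a : C) (x : 'cV[C]_n) :
  `|a| = 1 ->
  inner (KMS n a *m x) x + (inner (KMS n a *m x) x)^*%R + inner x x =
  `|\sum_(j < n) a ^+ j * x j 0| ^+ 2.
Proof.
move=> a1; have aa : a * a^*%R = 1 by rewrite -normCK a1 expr1n.
rewrite KMS_form_unimodular// normCK [RHS]mulrC.
rewrite [in RHS]rmorph_sum [RHS]mulr_suml /=.
rewrite [in LHS]rmorph_sum /=.
have -> : \sum_(i < n) (\sum_(j < n | (i < j)%N)
    a ^+ j * x j 0 * (a ^+ i * x i 0)^*%R)^*%R =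
    \sum_(i < n) \sum_(j < n | (j < i)%N) a ^+ j * x j 0 * (a ^+ i * x i 0)^*%R.
  under eq_bigr do rewrite rmorph_sum big_mkcond /=.
  rewrite exchange_big /=; apply: eq_bigr => i _; rewrite [RHS]big_mkcond.
  by apply: eq_bigr => j _; case: ifP => // _; rewrite rmorphM /= conjCK mulrC.
rewrite innerE -!big_split; apply: eq_bigr => i _ /=.
rewrite mulr_sumr [RHS](bigD1 i)//= [RHS]addrC.
rewrite [X in _ = X + _](bigID (fun j : 'I_n => (i < j)%N))/=.
congr (_ + _ + _).
- by apply: eq_big => [j|j _]; [rewrite -val_eqE /=; case: ltngtP|rewrite mulrC].
- by apply: eq_big => [j|j _]; [rewrite -val_eqE /=; case: ltngtP|rewrite mulrC].
rewrite rmorphM rmorphXn /=.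
transitivity (x i 0 * (x i 0)^*%R * (a * a^*%R) ^+ i).
  by rewrite aa expr1n mulr1.
by rewrite exprMn; ring.
Qed.

Lemma sum_ord_first3 (V : nmodType) m (F : nat -> V) :
  (forall i, (3 <= i)%N -> F i = 0) -> \sum_(i < 3 + m) F i = F 0 + F 1 + F 2.
Proof.
move=> F0; rewrite big_split_ord /= [X in _ + X]big1 ?addr0.
  by rewrite !big_ord_recl big_ord0 addr0 addrA.
by move=> i _; apply: F0; rewrite leq_addr.
Qed.

(** Here [e] stands for [i] or [- i], which yields two points with real part -1/2. *)
Lemma KMS_unimodular_point (C : numClosedFieldType) m (a e : C) :
  `|a| = 1 -> e ^+ 2 = -1 -> e^*%R = - e ->
  numerical_range (KMS (3 + m) a) ((e - 2) / 4).
Proof.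
move=> a1 ee ce; have aa : a * a^*%R = 1 by rewrite -normCK a1 expr1n.
(* The coordinates [y_j = a^j x_j] are to sum to 0, the equality case of [KMS_form_re]; the default
   0 of [nth] pads them. The squared norm is [1 + 1 + 2 = 4] and the form is
   [e ^+ 2 + e - 1 = e - 2]. *)
pose c := nth 0 [:: 1; e; -1 - e].
pose x : 'cV[C]_(3 + m) := \col_j ((a ^+ j)^*%R * c j).
have xE (j : 'I_(3 + m)) : a ^+ j * x j 0 = c j.
  by rewrite mxE rmorphXn mulrA -exprMn aa expr1n mul1r.
have c0 i : (3 <= i)%N -> c i = 0 by move=> i3; rewrite /c nth_default.
have xx : inner x x = 4.
  rewrite innerE.
  transitivity (\sum_(i < 3 + m) c i * (c i)^*%R).
    apply: eq_bigr => i _; rewrite -xE rmorphM rmorphXn /=.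
    transitivity (x i 0 * (x i 0)^*%R * (a * a^*%R) ^+ i).
      by rewrite aa expr1n mulr1.
    by rewrite exprMn; ring.
  rewrite (@sum_ord_first3 _ _ (fun i => c i * (c i)^*%R)).
    rewrite /c/= rmorphB rmorphN /= ce rmorph1.
    transitivity (2 - e ^+ 2 *+ 2); first by ring.
    by rewrite ee; ring.
  by move=> i /c0 ->; rewrite mul0r.
apply: (@numerical_rangeZ _ _ _ x).
  by rewrite -inner_eq0 xx pnatr_eq0.
rewrite xx divfK ?pnatr_eq0// KMS_form_unimodular//.
transitivity (\sum_(i < 3 + m) \sum_(j < 3 + m)
    (if (i < j)%N then c j else 0) * (c i)^*%R).
  apply: eq_bigr => i _; rewrite big_mkcond; apply: eq_bigr => j _.
  by rewrite !xE; case: ifP => //; rewrite mul0r.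
under eq_bigr => i _.
  rewrite (@sum_ord_first3 _ _ (fun j =>
    (if (i < j)%N then c j else 0) * (c i)^*%R)).
    over.
  by move=> j /c0 ->; rewrite if_same mul0r.
rewrite (@sum_ord_first3 _ _ (fun i =>
  (if (i < 0)%N then c 0 else 0) * (c i)^*%R
  + (if (i < 1)%N then c 1 else 0) * (c i)^*%R
  + (if (i < 2)%N then c 2 else 0) * (c i)^*%R)).
  rewrite /c/= ce rmorph1.
  transitivity (e ^+ 2 + e - 1); first by ring.
  by rewrite ee; ring.
by move=> i /c0 ->; rewrite conjC0 !mulr0 !addr0.
Qed.

Lemma KMS_unimodular_segment (R : realType) m (a : R[i]) : `|a| = 1 ->
  contains_line_segment (boundary (numerical_range (KMS (3 + m) a))).
Proof.
move=> a1; set W := numerical_range _.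
have WRe z : W z -> -1 <= z + z^*%R.
  move=> /numerical_rangeP[x [x1 <-]].
  by rewrite -subr_ge0 opprK -x1 KMS_form_re// exprn_ge0.
have iN : ('i%C : R[i])^*%R = - 'i%C by apply/eqP; rewrite eq_complex; simpc.
have i2 : 'i%C ^+ 2 = -1 :> R[i] by rewrite sqr_i.
have Wp : W (('i%C - 2) / 4) by exact: KMS_unimodular_point.
have Wq : W ((- 'i%C - 2) / 4).
  by apply: KMS_unimodular_point; rewrite ?sqrrN// rmorphN /= iN.
exists (('i%C - 2) / 4), ((- 'i%C - 2) / 4); split.
  have n4 : 4^-1 != 0 :> R[i] by rewrite invr_eq0 pnatr_eq0.
  move=> /(mulIf n4)/addIr/eqP.
  rewrite eq_complex /= => /andP[_].
  by rewrite -subr_eq0 opprK -mulr2n pnatr_eq0.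
move=> _ [t /= /andP[t0 t1] <-].
have Wz : W ((1 - t)%:C * (('i%C - 2) / 4) + t%:C * ((- 'i%C - 2) / 4)).
  rewrite rmorphB rmorph1; apply: numerical_range_convex => //.
  by rewrite !lecR t0.
have zRe : (1 - t)%:C * (('i%C - 2) / 4) + t%:C * ((- 'i%C - 2) / 4) +
    ((1 - t)%:C * (('i%C - 2) / 4) + t%:C * ((- 'i%C - 2) / 4))^*%R = -1 :> R[i].
  have tc : t%:C^*%R = t%:C :> R[i] by exact: conjc_real.
  rewrite rmorphB rmorph1 /=; move: (t%:C) tc => c cc.
  rewrite !(rmorphD, rmorphN, rmorphM, rmorph1, fmorphV) /= iN cc.
  by field.
move: Wz zRe; set z := _ + _ => Wz zRe; split; first exact: subset_closure.
(* If [z] were interior, a point slightly to its left would lie in [W] with real part below -1/2. *)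
move=> /interior_ball[e e0 /(_ (z - (e / 2)%:C))].
have eC : (e / 2)%:C^*%R = (e / 2)%:C :> R[i] by exact: conjc_real.
rewrite opprB addrC subrK ger0_norm ?ler0c ?divr_ge0 ?ltW// ltcR.
rewrite gtr_pMr// invf_lt1// ltr1n => /(_ isT)/WRe.
rewrite rmorphB /= eC addrACA zRe -subr_ge0 opprK addrAC addNr add0r -opprD.
rewrite oppr_ge0 -rmorphD /= -splitr lecR leNgt e0.
by [].
Qed.

(** * No segment in the remaining cases, and conclusion *)

Lemma KMS_no_segment (R : realType) n (a : R[i]) :
  (n.+1 < 3)%N || (`|a| != 1) ->
  ~ contains_line_segment (boundary (numerical_range (KMS n.+1 a))).
Proof.
set W := numerical_range _ => na [p [q [/eqP pq pqW]]].
have WB z : segment p q z -> W z /\ ~ interior W z.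
  by move=> /pqW[cz iz]; split=> //; exact: (numerical_range_closed cz).
have [Wp _] : W p /\ ~ interior W p.
  by apply: WB; exists 0; rewrite /= ?lexx ?ler01// subr0 mul1r mul0r addr0.
have [Wq _] : W q /\ ~ interior W q.
  by apply: WB; exists 1; rewrite /= ?lexx ?ler01// subrr mul0r mul1r add0r.
(* The midpoint is where [segment_support] needs a non-interior point. *)
have [_ nint] : W ((p + q) / 2) /\ ~ interior W ((p + q) / 2).
  apply: WB; exists 2^-1.
    by rewrite /= invr_ge0 ler0n invf_le1 ?ler1n ?ltr0n.
  by rewrite rmorphB fmorphV rmorph1 rmorph_nat /=; field.
(* The recurrences determine nothing for [a = 0], but then the matrix is zero and [W] is a single
   point. *)
have [a0|a0] := eqVneq a 0.
  have W0 z : W z -> z = 0.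
    move=> /numerical_rangeP[x [_ <-]].
    have -> : KMS n.+1 a = 0.
      apply/matrixP => i j; rewrite !mxE; case: ifP => // ij.
      by rewrite a0 expr0n subn_eq0 leqNgt ij.
    by rewrite mul0mx innerE big1// => i _; rewrite mxE mul0r.
  by rewrite (W0 _ Wp) (W0 _ Wq) eqxx in pq.
have qp : q != p by rewrite eq_sym.
have [w [k [w0 Wk pk qk]]] :=
  segment_support (@numerical_range_convex _ _ _) Wp Wq qp nint.
by rewrite (KMS_face_unique a0 w0 na Wk Wp Wq pk qk) eqxx in pq.
Qed.

Theorem proposition2p11 (R : realType) (n : nat) (hn : (1 <= n)%N) (a : R[i]) :
  contains_line_segment (boundary (numerical_range (KMS n a)))
  <-> (3 <= n)%N /\ `|a| = 1.
Proof.
case: n hn => // n _; split=> [seg|[n3 a1]].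
  have /negP : ~ ((n.+1 < 3)%N || (`|a| != 1)) by move/KMS_no_segment.
  by rewrite negb_or negbK -leqNgt => /andP[n3 /eqP].
have [m nE] : exists m, n.+1 = (3 + m)%N by exists (n.+1 - 3)%N; rewrite subnKC.
by rewrite nE; exact: KMS_unimodular_segment.
Qed.
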